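(* Let $(Z_t)$ be i.i.d. de Finetti sequences with measure $\nu$, let $(X_t)$ be the random walk $X_{t+1}=X_t+Z_t\bmod 2$ on $\mathcal V_\infty$ with $X_0=0$, and let it be stopped at $T_\alpha$. With $\rho_k=\mathbb E\big[(-1)^{Z[1]+\cdots+Z[k]}\big]$, $$\frac{1}{1+\frac{\alpha}{1-\alpha}(1-\rho_k)}=\mathbb E\big[Y^k\big],\qquad k\in\mathbb N,$$ where $Y$ is a random variable on $[-1,1]$ which is the product of the points in a point process with probability generating functional $$G[f]=\frac{f(1)}{1+\frac{\alpha}{1-\alpha}\int_{[-1,1]}(1-f(\xi))\,\nu^{[-1,1]}(d\xi)}.$$ Take $x_N,y_N\in\mathcal V_N$ as $N$ particular entries in the random walk on $\mathcal V_\infty$. The Green function for the random walk of these $N$ entries satisfies $$(1-\alpha)G(x_N,y_N;\alpha)=\mathbb E\Big[\Big(\frac12-\frac Y2\Big)^{\|y_N-x_N\|}\Big(\frac12+\frac Y2\Big)^{N-\|y_N-x_N\|}\Big].$$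
   Context: $\mathcal V_N=\{0,1\}^N$, $\mathcal V_\infty=\{0,1\}^\infty$, $\mathbb N=\{0,1,2,\dots\}$. A de Finetti sequence with measure $\nu$ (a probability measure on $[0,1]$) is an exchangeable $\{0,1\}$-valued sequence which, conditionally on $\omega$ with law $\nu$, is i.i.d. Bernoulli$(\omega)$. $Z$ denotes a generic copy of $Z_t$; $Z[j]$ is its $j$-th entry; $\rho_0=1$. $Z_t$ is independent of $(X_\tau)_{\tau\le t}$. $\nu^{[-1,1]}$ is the law of $1-2\omega$ when $\omega$ has law $\nu$. $\alpha\in(0,1)$ does not depend on $N$, and $T_\alpha$ is a random time independent of the walk with $\mathbb P(T_\alpha=t)=(1-\alpha)\alpha^t$, $t\in\mathbb N$. The Green function of the walk of $N$ entries is $G(x,y;\alpha)=\sum_{t\ge0}\alpha^t\,\mathbb P_t(y\mid x)$, where $\mathbb P_t(y\mid x)$ is the $t$-step transition probability of the walk restricted to the $N$ chosen entries. $\|y-x\|$ is the Hamming distance (number of entries in which $x$ and $y$ differ). The probability generating functional of a point process with points $(\xi_j)$ is $G[f]=\mathbb E\big[\prod_j f(\xi_j)\big]$ for measurable $0\le f\le1$; the displayed one is that of the point process consisting of one point at $1$ and $T_\alpha$ i.i.d. points with law $\nu^{[-1,1]}$ (independent of $T_\alpha$). Convention: $0^0=1$. *)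

(* Defs.v *)
From HB Require Import structures.
From mathcomp Require Import all_boot all_order all_algebra fingroup perm finmap.
From mathcomp Require Import all_classical all_reals all_analysis measurable_realfun.
Import Order.TTheory GRing.Theory Num.Theory numFieldNormedType.Exports.

Set Implicit Arguments.
Unset Strict Implicit.
Unset Printing Implicit Defensive.

Local Open Scope classical_set_scope.
Local Open Scope ring_scope.

(** A random element of {0,1}^oo is a family of boolean random variables indexed
    by [nat]: entry number [j] is stored at index [j - 1]. *)

Section independence.
Context d (Omega : measurableType d) (R : realType) (P : probability Omega R).

(** The sigma-algebra generated by the whole family [X], as a set of events. *)
Definition sigma_gen (I : Type) d' (S : measurableType d') (X : I -> Omega -> S)
    : set (set Omega) :=
  <<s \bigcup_i g_sigma_algebra_preimage (X i) >>.

Definition mutually_independent (I : choiceType) (F : I -> set (set Omega)) :=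
  forall (J : {fset I}) (E : I -> set Omega),
    (forall i, i \in J -> F i (E i)) ->
    P (\bigcap_(i in [set` J]) E i) = (\prod_(i <- J) P (E i))%E.

Definition independent (F G : set (set Omega)) :=
  forall A B, F A -> G B -> P (A `&` B) = (P A * P B)%E.

End independence.

Section de_finetti.
Context d (Omega : measurableType d) (R : realType) (P : probability Omega R).

Definition exchangeable (Z : nat -> {RV P >-> bool}) :=
  forall n (s : {perm 'I_n}) (z : 'I_n -> bool),
    P [set w | forall i, Z (s i) w = z i] = P [set w | forall i : 'I_n, Z i w = z i].

(** Given [W], the entries of [Z] are i.i.d. with
    P(Z i = true | W) = W: the conditional probability of each cylinder is
    written out by integrating over the events of sigma(W). *)
Definition conditionally_iid_bernoulli (Z : nat -> {RV P >-> bool})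
    (W : {RV P >-> R}) :=
  forall n (z : 'I_n -> bool) (A : set R), measurable A ->
    P ([set w | forall i : 'I_n, Z i w = z i] `&` W @^-1` A) =
    (\int[P]_(w in W @^-1` A) (\prod_(i < n) bernoulli_pmf (W w) (z i))%:E)%E.

Definition de_finetti (nu : probability R R) (Z : nat -> {RV P >-> bool}) :=
  exchangeable Z /\
  exists W : {RV P >-> R},
    (forall A : set R, measurable A -> distribution P W A = nu A) /\
    conditionally_iid_bernoulli Z W.

(** rho_k = E[(-1)^(Z[1] + ... + Z[k])] *)
Definition rho (Z : nat -> {RV P >-> bool}) (k : nat) : R :=
  fine 'E_P[fun w => (-1) ^+ (\sum_(i < k) Z i w)%N].

End de_finetti.

Section walk.
Context d (Omega : measurableType d).

(** The walk with increments [Z] started from [x], with entries indexed by [I];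
    addition mod 2 is exclusive or. *)
Fixpoint walk (I : Type) (x : I -> bool) (Z : nat -> I -> Omega -> bool)
    (t : nat) (i : I) (w : Omega) : bool :=
  if t is s.+1 then walk x Z s i w (+) Z s i w else x i.

Context (R : realType) (P : probability Omega R).

(** [transition Z c t y x] is P_t(y | x), the probability that the walk of the
    [N] entries selected by [c], started from [x], is at [y] after [t] steps. *)
Definition transition (Z : nat -> nat -> {RV P >-> bool}) (N : nat)
    (c : 'I_N -> nat) (t : nat) (y x : {ffun 'I_N -> bool}) : \bar R :=
  P [set w | forall i : 'I_N, walk x (fun s j => Z s (c j)) t i w = y i].

Definition green (Z : nat -> nat -> {RV P >-> bool}) (N : nat)
    (c : 'I_N -> nat) (x y : {ffun 'I_N -> bool}) (alpha : R) : \bar R :=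
  (\sum_(0 <= t <oo) (alpha ^+ t)%:E * transition Z c t y x)%E.

End walk.

Definition hamming (N : nat) (x y : {ffun 'I_N -> bool}) : nat :=
  #|[set i | x i != y i]|.

Section symmetrized_law.
Context (R : realType).

Definition one_minus_double (u : R) : R := 1 - 2 * u.

Let measurable_one_minus_double : measurable_fun [set: R] one_minus_double.
Proof. by apply: measurable_funB => //; exact: measurable_funM. Qed.

HB.instance Definition _ := isMeasurableFun.Build _ _ R R one_minus_double
  measurable_one_minus_double.

(** The law of 1 - 2 omega when omega has law [nu]. *)
Definition sym_law (nu : probability R R) : probability R R :=
  distribution nu one_minus_double.

End symmetrized_law.

Section point_process.
Context d (Omega : measurableType d) (R : realType) (P : probability Omega R).

(** A point process on [-1, 1] with finitely many points, listed with
    multiplicity: [pp_point 0], ..., [pp_point (pp_card - 1)].  The variables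
    [pp_point j] with [j >= pp_card] are not points and are irrelevant. *)
Record point_process := PointProcess {
  pp_card : {RV P >-> nat};
  pp_point : nat -> {RV P >-> R};
  pp_point_itv : forall w j, (j < pp_card w)%N -> -1 <= pp_point j w <= 1 }.

Definition pp_prod (xi : point_process) (f : R -> R) (w : Omega) : R :=
  \prod_(j < pp_card xi w) f (pp_point xi j w).

Definition pgfl (xi : point_process) (f : R -> R) : \bar R :=
  'E_P[pp_prod xi f].

Definition has_pgfl (xi : point_process) (G : (R -> R) -> R) :=
  forall f : R -> R, measurable_fun `[(-1 : R), 1] f ->
    (forall u, -1 <= u <= 1 -> 0 <= f u <= 1) -> pgfl xi f = (G f)%:E.

End point_process.

Definition geometric_pgfl (R : realType) (nu : probability R R) (alpha : R)
    (f : R -> R) : R :=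
  f 1 / (1 + alpha / (1 - alpha) *
             \int[sym_law nu]_(u in `[(-1 : R), 1]) (1 - f u)).

(* Main.v *)
Require Import Defs.
From HB Require Import structures.
From mathcomp Require Import all_boot all_order all_algebra fingroup perm finmap.
From mathcomp Require Import all_classical all_reals all_analysis measurable_realfun.
From mathcomp Require Import ring lra.
Import Order.TTheory GRing.Theory Num.Theory numFieldNormedType.Exports.

Set Implicit Arguments.
Unset Strict Implicit.
Unset Printing Implicit Defensive.

Local Open Scope classical_set_scope.
Local Open Scope ring_scope.

(** Write [a := alpha / (1 - alpha)] and let [m_k] be the [k]-th moment of
    [1 - 2 omega], [omega] of law [nu].  Given [omega], the signs [(-1)^Z[j]]
    are independent with mean [1 - 2 omega], so the expectation of the product of
    any [k] of them is [m_k] ([de_finetti_character]); in particular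
    [rho_k = m_k] ([rhoE]).

    Moments of [Y].  Formally [E[Y^k]] is the generating functional at
    [f(u) = u^k], which equals [1 / (1 + a (1 - m_k))].  For odd [k] this [f] is
    not a test function, since it takes negative values.  One tests instead
    [f_x(u) = |u|^k x^[u < 0]] with [0 <= x <= 1] ([signed_power]).  The product
    of the [f_x] over the points is [V x^M], where [V] is the product of the
    [|xi_j|^k] and [M] is the number of negative points.  Hence [E[V x^M]] is a
    power series in [x] with nonnegative coefficients, and on [0,1] it coincides
    with [1 / (1 + a (1 - (p + x q)))], where [p] and [q] are the integrals of
    [|u|^k] over [u >= 0] and [u < 0] for the law of [1 - 2 omega].  The latter
    is a geometric series of ratio less than 1, so [power_series_coef_unique]
    identifies the coefficients and the equality persists at [x = (-1)^k], where [f_x(u) = u^k] and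
    [p + x q = m_k] ([expectation_pp_prod_power]).

    Green function.  By Fourier analysis on [{0,1}^N], the characters being
    indexed by subsets [A] of the entries, the distribution of the walk after [t]
    independent steps has Fourier coefficients [m_|A|^t] ([transitionE]).
    Summing the geometric series in [t] turns them into
    [1 / (1 - alpha m_|A|) = 1 / ((1 - alpha) (1 + a (1 - m_|A|)))], that is
    [E[Y^|A|] / (1 - alpha)] ([greenE]).  Inverting the transform amounts to
    expanding the product over the entries of [(1 + Y) / 2] or [(1 - Y) / 2]
    ([fourier_hamming]).

    Existence.  Conditioned on having [n] points besides the one at 1, the
    process is [n] i.i.d. points, and these laws are built by induction on [n]:
    one draws a first point and, independently, a configuration of [n - 1] points
    ([iid_points]).  Mixing them with geometric weights gives the process, whose
    functional is the sum of the geometric series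
    [f(1) (1 - alpha) sum_n (alpha int f)^n] ([geometric_process_pgfl]). *)

(** * Power series with nonnegative coefficients *)

Lemma geometric_eseries (R : realType) (a z : R) : `|z| < 1 ->
  (\sum_(0 <= i <oo) (a * z ^+ i)%:E)%E = (a / (1 - z))%:E.
Proof.
move=> z1; apply: cvg_lim => //.
rewrite (_ : (fun _ => _) = EFin \o series (geometric a z)); last first.
  by apply/funext => n /=; rewrite /series /= -sumEFin.
by apply: cvg_EFin; [exact: nearW | exact: cvg_geometric_series].
Qed.

(** The earlier coefficients agree, so both sums can be stripped of them.  What
    remains is at least [c n * x ^+ n] on one side and at most
    [(d n + x * S) * x ^+ n] on the other; let [x] tend to 0. *)
Lemma le_power_series_coef (R : realType) (c d : nat -> R) (S : R) :
  (forall i, 0 <= c i) -> (forall i, 0 <= d i) ->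
  (\sum_(0 <= i <oo) (d i)%:E <= S%:E)%E ->
  (forall x, 0 <= x <= 1 ->
    (\sum_(0 <= i <oo) (c i * x ^+ i)%:E = \sum_(0 <= i <oo) (d i * x ^+ i)%:E)%E) ->
  forall n, (forall i, (i < n)%N -> c i = d i) -> c n <= d n.
Proof.
move=> c0 d0 dS cd n IH.
have S0 : 0 <= S.
  by rewrite -lee_fin; apply: le_trans dS; apply: nneseries_ge0 => i _ _; rewrite lee_fin.
apply/ler_addgt0Pr => e e0.
(* small enough for the error [x * S] to be at most [e] *)
pose x := Num.min 1 (e / (S + 1)).
have S1 : 0 < S + 1 by rewrite ltr_wpDl.
have x0 : 0 < x by rewrite lt_min ltr01 divr_gt0.
have x1 : x <= 1 by rewrite ge_min lexx.
have xS : x * S <= e.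
  rewrite (@le_trans _ _ (x * (S + 1)))//.
    by rewrite ler_pM2l// lerDl.
  by rewrite -ler_pdivlMr// ge_min lexx orbT.
have x01 : 0 <= x <= 1 by rewrite (ltW x0) x1.
have pos (b : nat -> R) : (forall i, 0 <= b i) -> forall k, (0 <= (b k * x ^+ k)%:E)%E.
  by move=> b0 k; rewrite lee_fin mulr_ge0// exprn_ge0// ltW.
have := cd x x01.
rewrite (nneseries_split 0 n) ?add0n; last by move=> k _; exact: pos.
rewrite [in RHS](nneseries_split 0 n) ?add0n; last by move=> k _; exact: pos.
rewrite (@eq_big_nat _ _ _ 0 n (fun k => (c k * x ^+ k)%:E)
  (fun k => (d k * x ^+ k)%:E)); last first.
  by move=> i /andP[_ i_n]; rewrite IH.
rewrite sumEFin; set pre := (\sum_(0 <= i < n) _)%:E.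
move=> /(congr1 (fun z => (z - pre)%E)); rewrite 2!(addeC pre) 2?addeK// => tails.
have : ((c n * x ^+ n)%:E <= ((d n + x * S) * x ^+ n)%:E)%E.
  apply: (@le_trans _ _ (\sum_(n <= k <oo) (c k * x ^+ k)%:E)%E).
    apply: le_trans (nneseries_lim_ge n.+1 _); first by rewrite big_nat1.
    by move=> k _ _; exact: pos.
  rewrite tails (nneseries_split n 1); last by move=> k _; exact: pos.
  rewrite addn1 big_nat1 mulrDl EFinD leeD2l//.
  apply: (@le_trans _ _ (\sum_(n.+1 <= k <oo) ((x ^+ n.+1)%:E * (d k)%:E))%E).
    rewrite eseries_cond [leRHS]eseries_cond.
    apply: lee_nneseries => [k _ _|k /andP[_ nk]]; first exact: pos.
    by rewrite -EFinM lee_fin mulrC ler_wpM2r// ler_wiXn2l// ltW.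
  rewrite nneseriesZl; last by move=> k _; rewrite lee_fin.
  rewrite mulrAC -exprS EFinM lee_wpmul2l//; first by rewrite lee_fin exprn_ge0// ltW.
  apply: le_trans dS; rewrite [leRHS](nneseries_split 0 n.+1) ?add0n; last first.
    by move=> k _; rewrite lee_fin.
  apply: leeDr.
  by rewrite sumEFin lee_fin sumr_ge0.
rewrite lee_fin ler_pM2r ?exprn_gt0// => /le_trans; apply.
by rewrite lerD2l.
Qed.

Lemma power_series_coef_unique (R : realType) (c d : nat -> R) (S : R) :
  (forall i, 0 <= c i) -> (forall i, 0 <= d i) ->
  (\sum_(0 <= i <oo) (d i)%:E <= S%:E)%E ->
  (forall x, 0 <= x <= 1 ->
    (\sum_(0 <= i <oo) (c i * x ^+ i)%:E = \sum_(0 <= i <oo) (d i * x ^+ i)%:E)%E) ->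
  c =1 d.
Proof.
move=> c0 d0 dS cd n; elim/ltn_ind: n => n IH.
have cS : (\sum_(0 <= i <oo) (c i)%:E <= S%:E)%E.
  apply: le_trans dS; have := cd 1; rewrite ler01 lexx => /(_ isT).
  under eq_eseriesr do rewrite expr1n mulr1.
  by under [RHS]eq_eseriesr do rewrite expr1n mulr1; move=> ->.
apply/eqP; rewrite eq_le; apply/andP; split.
  exact: (le_power_series_coef c0 d0 dS cd IH).
apply: (le_power_series_coef d0 c0 cS) => [x x01|i i_n]; first by rewrite cd.
by rewrite IH.
Qed.

(** * Measurability and integration *)

Lemma bounded_integrable d (T : measurableType d) (R : realType)
    (P : probability T R) (D : set T) (f : T -> R) (M : R) : measurable D ->
  measurable_fun D f -> (forall x, D x -> `|f x| <= M) ->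
  P.-integrable D (EFin \o f).
Proof.
move=> mD mf fM; apply: measurable_bounded_integrable => //.
  by rewrite (le_lt_trans (probability_le1 P mD))// ltry.
exists M; split; first exact: num_real.
by move=> y My x Dx; exact: le_trans (fM _ Dx) (ltW My).
Qed.

(** This is what makes products and sums over the random number of points of a
    point process measurable. *)
Lemma measurable_fun_random_index d d' (T : measurableType d)
    (S : measurableType d') (N : T -> nat) (F : nat -> T -> S) :
  measurable_fun setT N -> (forall n, measurable_fun setT (F n)) ->
  measurable_fun setT (fun w => F (N w) w).
Proof.
move=> mN mF _ B mB; rewrite setTI.
rewrite (_ : _ @^-1` B = \bigcup_n (N @^-1` [set n] `&` F n @^-1` B)).
  apply: bigcupT_measurable => n; apply: measurableI.
    by rewrite -[X in measurable X]setTI; exact: mN.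
  by rewrite -[X in measurable X]setTI; exact: mF.
apply/seteqP; split => [w /= Bw|w [n _] [/= <-]//].
by exists (N w).
Qed.

Lemma measurable_forall d (T : measurableType d) (I : finType) (B : I -> set T) :
  (forall i, measurable (B i)) -> measurable [set w | forall i, B i w].
Proof.
move=> mB; rewrite (_ : mkset _ = \bigcap_(i in [set: I]) B i).
  by apply: fin_bigcap_measurable => // i _; exact: mB.
by apply/seteqP; split => w Bw i //; exact: Bw.
Qed.

Lemma probability_setI1 d (T : measurableType d) (R : realType)
    (P : probability T R) (A B : set T) :
  measurable A -> measurable B -> P B = 1%E -> P (A `&` B) = P A.
Proof.
move=> mA mB PB; transitivity (P (A `\` B) + P (A `&` B))%E; last first.
  exact/esym/measureDI.
have PB0 : P (~` B) = 0%E by rewrite probability_setC// PB subee.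
suff -> : P (A `\` B) = 0%E by rewrite add0e.
apply/eqP; rewrite eq_le measure_ge0 andbT -PB0 le_measure ?inE//.
- exact: measurableD.
- exact: measurableC.
Qed.

Lemma Rintegral_sum d (T : measurableType d) (R : realType)
    (mu : {measure set T -> \bar R}) (D : set T) (I : Type) (s : seq I)
    (f : I -> T -> R) : measurable D ->
  (forall i, mu.-integrable D (EFin \o f i)) ->
  \int[mu]_(x in D) (\sum_(i <- s) f i x) = \sum_(i <- s) \int[mu]_(x in D) f i x.
Proof.
move=> mD intf.
transitivity (fine (\sum_(i <- s) \int[mu]_(x in D) (f i x)%:E)%E).
  congr fine; under eq_integral do rewrite -sumEFin.
  exact: integral_sum.
rewrite (eq_bigr (fun i => (\int[mu]_(x in D) f i x)%:E)) ?sumEFin// => i _.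
by rewrite fineK//; exact: integrable_fin_num (intf i).
Qed.

Section finite_valued.
Context d (Omega : measurableType d) (R : realType) (P : probability Omega R).

Lemma expectation_finite_valued (F : finType) (X : Omega -> F) (g : F -> R) :
  (forall z, measurable [set w | X w = z]) ->
  'E_P[fun w => g (X w)]%E = (\sum_z g z * fine (P [set w | X w = z]))%:E.
Proof.
move=> mX; rewrite unlock.
transitivity (\int[P]_w (\sum_z (g z)%:E * (\1_[set w | X w = z] w)%:E)%E)%E.
  apply: eq_integral => w _; rewrite (bigD1 (X w))//= big1 => [|z zX].
    by rewrite indicE mem_set// mule1 adde0.
  by rewrite indicE memNset ?mule0//= => Xz; rewrite Xz eqxx in zX.
rewrite integral_sum//; last first.
  by move=> z; apply: integrableZl => //; exact: integrable_indic.
rewrite -sumEFin; apply: eq_bigr => z _.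
rewrite integralZl//; last exact: integrable_indic.
by rewrite integral_indic// setIT EFinM fineK// fin_num_measure.
Qed.

End finite_valued.

(** * Signed powers over a point process *)

Section signed_powers.
Context (R : realType).

(** For [0 <= x <= 1] an admissible test function of a generating functional;
    for [x = (-1) ^+ k] it is the power [u ^+ k]. *)
Definition signed_power (k : nat) (x u : R) : R := `|u| ^+ k * x ^+ (u < 0)%R.

Lemma measurable_lt0 : measurable_fun [set: R] (fun u => ((u < 0)%R : nat)%:R : R).
Proof.
rewrite (_ : (fun _ => _) = \1_([set` `]-oo, (0 : R)[])).
  exact: measurable_indic.
by apply/funext => u; rewrite indicE mem_setE in_itv.
Qed.

Lemma signed_powerE k x u : signed_power k x u =
  `|u| ^+ k * (1 - ((u < 0)%R : nat)%:R) + x * (`|u| ^+ k * ((u < 0)%R : nat)%:R).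
Proof. by rewrite /signed_power; case: (u < 0); rewrite /= ?expr1 ?expr0; ring. Qed.

Lemma measurable_abs_power k : measurable_fun [set: R] (fun u : R => `|u| ^+ k).
Proof.
exact: (measurable_funX _ (measurableT_comp (@normr_measurable R setT)
  (@measurable_id _ R setT))).
Qed.

Lemma measurable_signed_power k x : measurable_fun [set: R] (signed_power k x).
Proof.
rewrite (funext (signed_powerE k x)).
have m1 := measurable_abs_power k; have m2 := measurable_lt0.
apply: measurable_funD; apply: measurable_funM => //.
  exact: measurable_funB.
exact: measurable_funM.
Qed.

Lemma signed_power_sign k u : signed_power k ((-1) ^+ k) u = u ^+ k.
Proof.
rewrite /signed_power; case: ltP => [u0|u0].
  by rewrite expr1 ltr0_norm// -exprMn mulrN1 opprK.
by rewrite mulr1 ger0_norm.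
Qed.

Lemma signed_power01 k x u : -1 <= u <= 1 -> 0 <= x <= 1 ->
  0 <= signed_power k x u <= 1.
Proof.
move=> u1 /andP[x0 x1]; have nu1 : `|u| <= 1 by rewrite ler_norml.
rewrite /signed_power mulr_ge0 ?exprn_ge0//=.
by apply: mulr_ile1; rewrite ?exprn_ge0// exprn_ile1.
Qed.

End signed_powers.

Section moments_of_the_product.
Context d (Omega : measurableType d) (R : realType) (P : probability Omega R).
Variable xi : point_process P.

Lemma measurable_pp_prod (g : R -> R) : measurable_fun setT g ->
  measurable_fun setT (pp_prod xi g).
Proof.
move=> mg.
apply: (@measurable_fun_random_index _ _ _ _ (pp_card xi)
  (fun n w => \prod_(j < n) g (pp_point xi j w))) => // n.
by apply: measurable_prod => i _; exact: measurableT_comp.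
Qed.

Lemma pp_prod_bounded (g : R -> R) : (forall u, -1 <= u <= 1 -> `|g u| <= 1) ->
  forall w, `|pp_prod xi g w| <= 1.
Proof.
move=> g1 w; rewrite /pp_prod normr_prod.
apply: Num.Theory.prodr_ile1 => j _.
by rewrite normr_ge0 g1//; exact: pp_point_itv.
Qed.

Definition negative_points (w : Omega) : nat :=
  (\sum_(j < pp_card xi w) (pp_point xi j w < 0)%R)%N.

Lemma measurable_negative_points m : measurable [set w | negative_points w = m].
Proof.
(* counted in [R], a sum of indicators of measurable sets *)
pose N w : R := (negative_points w)%:R.
have mN : measurable_fun setT N.
  rewrite (_ : N = fun w => \sum_(j < pp_card xi w) ((pp_point xi j w < 0)%R : nat)%:R).
    apply: (@measurable_fun_random_index _ _ _ _ (pp_card xi)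
      (fun n w => \sum_(j < n) ((pp_point xi j w < 0)%R : nat)%:R : R)) => // n.
    by apply: measurable_sum => i; exact: (measurableT_comp (@measurable_lt0 R)).
  by apply/funext => w; rewrite /N /negative_points natr_sum.
rewrite (_ : mkset _ = setT `&` N @^-1` [set m%:R]); first exact: mN.
rewrite setTI; apply/seteqP; split => [w /= <-//|w /= /eqP].
by rewrite /N eqr_nat => /eqP.
Qed.

Lemma pp_prod_signed_power k x w :
  pp_prod xi (signed_power k x) w = pp_prod xi (fun u => `|u| ^+ k) w * x ^+ negative_points w.
Proof. by rewrite /pp_prod /signed_power big_split /= prodrXr. Qed.

Definition neg_coef (k m : nat) : R :=
  \int[P]_(w in [set w | negative_points w = m]) pp_prod xi (fun u => `|u| ^+ k) w.

Lemma neg_coef_ge0 k m : 0 <= neg_coef k m.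
Proof.
by apply: Rintegral_ge0 => w _; apply: prodr_ge0 => j _; exact: exprn_ge0.
Qed.

(** Split the expectation according to the number of negative points.  The
    coefficients do not depend on [x], and the expansion holds on the whole of
    [[-1, 1]], beyond the values of [x] that give test functions. *)
Lemma expectation_signed_power k x : `|x| <= 1 ->
  ('E_P[pp_prod xi (signed_power k x)] =
   \sum_(0 <= m <oo) (neg_coef k m * x ^+ m)%:E)%E.
Proof.
move=> x1; rewrite unlock.
pose F m := [set w | negative_points w = m].
have UF : \bigcup_m F m = setT by apply/seteqP; split => // w _; exists (negative_points w).
have abs1 (u : R) : -1 <= u <= 1 -> `| `|u| ^+ k | <= 1.
  by move=> u1; rewrite ger0_norm ?exprn_ge0// exprn_ile1// ler_norml.
have intx : P.-integrable setT (EFin \o pp_prod xi (signed_power k x)).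
  apply: (@bounded_integrable _ _ _ _ _ _ 1) => //.
    by apply: measurable_pp_prod; exact: measurable_signed_power.
  move=> w _; apply: pp_prod_bounded => u u1.
  by rewrite normrM mulr_ile1 ?abs1// normrX exprn_ile1.
rewrite -UF in intx *; rewrite integral_bigcup//=; last 2 first.
- apply/trivIsetP => i j _ _ ij; apply/seteqP; split => // w [].
  by rewrite /F /= => -> /eqP; rewrite (negbTE ij).
- by move=> m; exact: measurable_negative_points.
apply: eq_eseriesr => m _; rewrite EFinM.
have mFm := measurable_negative_points m.
have intm : P.-integrable (F m) (EFin \o pp_prod xi (fun u => `|u| ^+ k)).
  apply: (@bounded_integrable _ _ _ _ _ _ 1) => //.
    by apply: measurable_funTS; apply: measurable_pp_prod; exact: measurable_abs_power.
  by move=> w _; exact: pp_prod_bounded.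
rewrite /neg_coef /Rintegral fineK; last exact: integrable_fin_num.
rewrite -integralZr//; apply: eq_integral => w; rewrite inE /F /= => <-.
by rewrite pp_prod_signed_power EFinM.
Qed.

End moments_of_the_product.

(** * Moments of the product of the points *)

Definition sym_moment (R : realType) (nu : probability R R) (k : nat) : R :=
  \int[sym_law nu]_(u in `[(-1 : R), 1]) u ^+ k.

Section symmetrized_moments.
Context (R : realType) (nu : probability R R).
Hypothesis nu01 : nu [set u | 0 <= u <= 1] = 1%E.

Lemma preimage_one_minus_double :
  @one_minus_double R @^-1` `[(-1 : R), 1]%classic = [set u | 0 <= u <= 1].
Proof.
apply/seteqP; split => u; rewrite /preimage /= in_itv/= /one_minus_double; lra.
Qed.

Lemma sym_law_itv : sym_law nu `[(-1 : R), 1]%classic = 1%E.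
Proof. by rewrite -nu01 -preimage_one_minus_double. Qed.

Lemma Rintegral_sym_law_cst (c : R) :
  \int[sym_law nu]_(u in `[(-1 : R), 1]) c = c.
Proof.
rewrite Rintegral_cst// [X in c * X](_ : _ = 1) ?mulr1//.
exact: (congr1 fine sym_law_itv).
Qed.

Lemma sym_law_integrable (f : R -> R) : measurable_fun setT f ->
  (forall u, -1 <= u <= 1 -> `|f u| <= 1) ->
  (sym_law nu).-integrable `[(-1 : R), 1]%classic (EFin \o f).
Proof.
move=> mf f1; apply: (@bounded_integrable _ _ _ _ _ _ 1) => //.
exact: measurable_funTS.
Qed.

(** The two halves of the [k]-th moment, separated because [signed_power k x]
    weights them differently. *)
Definition pos_moment k : R :=
  \int[sym_law nu]_(u in `[(-1 : R), 1]) (`|u| ^+ k * (1 - ((u < 0)%R : nat)%:R)).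

Definition neg_moment k : R :=
  \int[sym_law nu]_(u in `[(-1 : R), 1]) (`|u| ^+ k * ((u < 0)%R : nat)%:R).

Lemma abs_power_le1 k (u : R) (b : bool) : -1 <= u <= 1 -> `| `|u| ^+ k * b%:R| <= 1.
Proof.
move=> u1; rewrite normrM mulr_ile1//; last by case: b; rewrite ?normr1 ?normr0.
by rewrite ger0_norm ?exprn_ge0// exprn_ile1// ler_norml.
Qed.

Lemma integrable_pos k : (sym_law nu).-integrable `[(-1 : R), 1]%classic
  (EFin \o (fun u : R => `|u| ^+ k * (1 - ((u < 0)%R : nat)%:R))).
Proof.
apply: sym_law_integrable => [|u u1].
  apply: measurable_funM; first exact: measurable_abs_power.
  by apply: measurable_funB => //; exact: measurable_lt0.
rewrite (_ : 1 - _ = (~~ (u < 0)%R : nat)%:R); first exact: abs_power_le1.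
by case: (u < 0); rewrite /= ?subrr ?subr0.
Qed.

Lemma integrable_neg k : (sym_law nu).-integrable `[(-1 : R), 1]%classic
  (EFin \o (fun u : R => `|u| ^+ k * ((u < 0)%R : nat)%:R)).
Proof.
apply: sym_law_integrable => [|u u1]; last exact: abs_power_le1.
by apply: measurable_funM; [exact: measurable_abs_power | exact: measurable_lt0].
Qed.

Lemma integral_signed_power k x :
  \int[sym_law nu]_(u in `[(-1 : R), 1]) signed_power k x u =
  pos_moment k + x * neg_moment k.
Proof.
under eq_Rintegral do rewrite signed_powerE.
rewrite RintegralD//; last 2 first.
- exact: integrable_pos.
- apply: eq_integrable (integrableZl _ x (integrable_neg k)) => //.
by rewrite RintegralZl//; exact: integrable_neg.
Qed.

Lemma sym_momentE k : sym_moment nu k = pos_moment k + (-1) ^+ k * neg_moment k.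
Proof.
rewrite -integral_signed_power; apply: eq_Rintegral => u _.
by rewrite signed_power_sign.
Qed.

Lemma pos_moment_ge0 k : 0 <= pos_moment k.
Proof.
apply: Rintegral_ge0 => u _; rewrite mulr_ge0 ?exprn_ge0//.
by case: (u < 0); rewrite /= ?subrr ?subr0.
Qed.

Lemma neg_moment_ge0 k : 0 <= neg_moment k.
Proof. by apply: Rintegral_ge0 => u _; rewrite mulr_ge0 ?exprn_ge0. Qed.

Lemma pos_neg_moment_le1 k : pos_moment k + neg_moment k <= 1.
Proof.
rewrite -(mul1r (neg_moment k)) -integral_signed_power.
rewrite -[leRHS]Rintegral_sym_law_cst.
have sp1 (u : R) : -1 <= u <= 1 -> 0 <= signed_power k 1 u <= 1.
  by move=> u1; apply: signed_power01; rewrite ?ler01 ?lexx.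
apply: le_Rintegral => //.
- apply: sym_law_integrable; first exact: measurable_signed_power.
  by move=> u /sp1/andP[s0 s1]; rewrite ger0_norm.
- by apply: sym_law_integrable => // u _; rewrite normr1.
- by move=> u; rewrite /= in_itv/= => /sp1/andP[].
Qed.

Lemma sym_moment_le1 k : `|sym_moment nu k| <= 1.
Proof.
have := pos_neg_moment_le1 k; have := pos_moment_ge0 k; have := neg_moment_ge0 k.
rewrite sym_momentE -signr_odd; case: odd; rewrite ?expr1 ?expr0 ler_norml; lra.
Qed.

Context (alpha : R) (alpha01 : 0 < alpha < 1).

Lemma odds_gt0 : 0 < alpha / (1 - alpha).
Proof. by case/andP: alpha01 => a0 a1; rewrite divr_gt0 ?subr_gt0. Qed.

Lemma geometric_pgfl_signed_power k x : 0 <= x <= 1 ->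
  geometric_pgfl nu alpha (signed_power k x) =
  1 / (1 + alpha / (1 - alpha) * (1 - (pos_moment k + x * neg_moment k))).
Proof.
move=> x01; rewrite /geometric_pgfl RintegralB//; last 2 first.
- by apply: sym_law_integrable => // u _; rewrite normr1.
- apply: sym_law_integrable; first exact: measurable_signed_power.
  by move=> u u1; have /andP[s0 s1] := signed_power01 k u1 x01; rewrite ger0_norm.
rewrite Rintegral_sym_law_cst integral_signed_power.
by rewrite /signed_power ltr10 normr1 expr1n mulr1.
Qed.

(** The analytic continuation step: the expansion in the number of negative
    points agrees with a geometric series for [0 <= x <= 1], hence coefficient by
    coefficient, hence at [x = (-1) ^+ k], which is -1 for odd [k]. *)
Lemma expectation_pp_prod_power d (Omega : measurableType d)
    (P : probability Omega R) (xi : point_process P) k :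
  has_pgfl xi (geometric_pgfl nu alpha) ->
  ('E_P[(fun w => pp_prod xi id w ^+ k)%R])%E =
  (1 / (1 + alpha / (1 - alpha) * (1 - sym_moment nu k)))%:E.
Proof.
move=> xiG; have a0 := odds_gt0.
set a := alpha / (1 - alpha) in xiG a0 *.
set p := pos_moment k; set q := neg_moment k.
have p0 : 0 <= p by exact: pos_moment_ge0.
have q0 : 0 <= q by exact: neg_moment_ge0.
have pq1 : p + q <= 1 by exact: pos_neg_moment_le1.
(* [D - a * q * x] is the denominator at [x], so the series has ratio [r * x] *)
pose D := 1 + a * (1 - p); pose r := a * q / D.
have aq : a * q <= a * (1 - p) by rewrite ler_pM2l//; lra.
have aq0 : 0 <= a * q by rewrite mulr_ge0// ltW.
have D0 : 0 < D by rewrite /D; lra.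
have r0 : 0 <= r by rewrite /r divr_ge0// ltW.
have r1 : r < 1 by rewrite /r ltr_pdivrMr// mul1r /D; lra.
have sumD x : `|x| <= 1 ->
    (\sum_(0 <= i <oo) (1 / D * r ^+ i * x ^+ i)%:E)%E =
    (1 / (1 + a * (1 - (p + x * q))))%:E.
  move=> x1; under eq_eseriesr do rewrite -mulrA -exprMn.
  have rx1 : `|r * x| < 1.
    by rewrite normrM (ger0_norm r0) (le_lt_trans _ r1)// ler_piMr.
  rewrite geometric_eseries//; congr EFin.
  have : 1 - r * x != 0.
    by rewrite gt_eqF// subr_gt0 (le_lt_trans (ler_norm _)).
  have -> : 1 - r * x = (1 + a * (1 - (p + x * q))) / D.
    by rewrite /r /D; field; rewrite -/D gt_eqF.
  by move=> /[!mulf_eq0] /norP[n1 _]; field; rewrite n1 gt_eqF.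
have coefE := @power_series_coef_unique _ (neg_coef xi k) (fun i => 1 / D * r ^+ i)
  (1 / (1 + a * (1 - (p + q)))).
transitivity ('E_P[pp_prod xi (signed_power k ((-1) ^+ k))])%E.
  congr ('E_P[_])%E; apply/funext => w.
  rewrite /pp_prod -prodrXl; apply: eq_bigr => j _.
  by rewrite signed_power_sign.
have sgn1 : `|(-1) ^+ k : R| <= 1 by rewrite normrX normrN1 expr1n.
rewrite expectation_signed_power// sym_momentE -/p -/q -sumD//.
apply: eq_eseriesr => i _; rewrite coefE// => [j|j||x x01].
- exact: neg_coef_ge0.
- by rewrite mulr_ge0 ?exprn_ge0// divr_ge0// ltW.
- have := sumD 1; rewrite normr1 lexx (mul1r q) => /(_ isT) <-.
  by under [leRHS]eq_eseriesr do rewrite expr1n mulr1.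
- have nx1 : `|x| <= 1 by case/andP: x01 => x0 x1; rewrite ger0_norm.
  rewrite sumD// -expectation_signed_power//.
  rewrite -geometric_pgfl_signed_power//; apply: xiG.
    by apply: measurable_funTS; exact: measurable_signed_power.
  by move=> u u1; exact: signed_power01.
Qed.

End symmetrized_moments.

(** * Characters of de Finetti sequences *)

Section characters.
Context (R : realType).

(** The characters of the group [{0,1}^I]. *)
Definition character (I : finType) (A : {set I}) (z : I -> bool) : R :=
  \prod_(i in A) (-1) ^+ z i.

Lemma sum_bernoulli_character n (A : {set 'I_n}) (p : R) :
  \sum_(z : {ffun 'I_n -> bool}) character A z * \prod_(i < n) bernoulli_pmf p (z i) =
  (1 - 2 * p) ^+ #|A|.
Proof.
pose F (i : 'I_n) (b : bool) := (if i \in A then (-1) ^+ b else 1) * bernoulli_pmf p b.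
transitivity (\sum_(z : {ffun 'I_n -> bool}) \prod_i F i (z i)).
  by apply: eq_bigr => z _; rewrite /character big_mkcond -big_split.
rewrite -bigA_distr_bigA -prodr_const [RHS]big_mkcond; apply: eq_bigr => i _.
rewrite big_bool /F /bernoulli_pmf; case: (i \in A) => /=; ring.
Qed.

End characters.
Arguments character {R I}.

Section de_finetti_moments.
Context d (Omega : measurableType d) (R : realType) (P : probability Omega R).
Variable nu : probability R R.
Hypothesis nu01 : nu [set u | 0 <= u <= 1] = 1%E.

Lemma measurable_unit_interval : measurable [set u : R | 0 <= u <= 1].
Proof.
exact: (measurable_itv `[0, 1]).
Qed.

Lemma sym_moment_law (W : {RV P >-> R}) k :
  (forall A : set R, measurable A -> distribution P W A = nu A) ->
  sym_moment nu k = \int[P]_(w in W @^-1` [set u | 0 <= u <= 1]) (1 - 2 * W w) ^+ k.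
Proof.
move=> WE; have m01 := measurable_unit_interval.
set I := [set u : R | 0 <= u <= 1] in m01 *.
have mpow : measurable_fun [set: R] (fun u : R => (1 - 2 * u) ^+ k).
  by apply: measurable_funX; apply: measurable_funB => //; exact: measurable_funM.
have pow1 (u : R) : 0 <= u <= 1 -> `|(1 - 2 * u) ^+ k| <= 1.
  move=> u01; rewrite normrX exprn_ile1// ler_norml; lra.
congr fine.
transitivity (\int[nu]_(u in I) ((1 - 2 * u) ^+ k)%:E)%E.
  rewrite integral_pushforward//=.
  - by rewrite preimage_one_minus_double.
  - by apply/measurable_EFinP; exact: measurable_funX.
  rewrite preimage_one_minus_double.
  exact: (@bounded_integrable _ _ _ _ _ _ 1 _ (measurable_funTS mpow)).
rewrite (eq_measure_integral (distribution P W)); last by move=> A mA _; exact/esym/WE.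
rewrite integral_pushforward//=; first exact/measurable_EFinP.
apply: (@bounded_integrable _ _ _ _ _ _ 1).
- exact: measurable_funPTI.
- by apply: measurable_funTS; exact: (measurableT_comp mpow).
- by move=> w; exact: pow1.
Qed.

(** Given [W] the signs are independent of mean [1 - 2 * W].  All integrals are
    taken over the event [0 <= W <= 1], of probability 1, because the integrands,
    polynomials in [W], are known to be bounded only there. *)
Lemma de_finetti_character (Z : nat -> {RV P >-> bool}) n (A : {set 'I_n}) :
  de_finetti nu Z ->
  'E_P[fun w => character A (fun i : 'I_n => Z i w)]%E = (sym_moment nu #|A|)%:E.
Proof.
move=> [_ [W [WE WZ]]].
pose X w : {ffun 'I_n -> bool} := [ffun i : 'I_n => Z i w].
have XE z : [set w | X w = z] = [set w | forall i : 'I_n, Z i w = z i].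
  apply/seteqP; split => w /= => [<- i|h]; first by rewrite ffunE.
  by apply/ffunP => i; rewrite ffunE.
have mX z : measurable [set w | X w = z].
  rewrite XE; apply: (@measurable_forall _ _ 'I_n (fun i => Z i @^-1` [set z i])) => i.
  exact: measurable_funPTI.
transitivity ('E_P[fun w => character A (X w)])%E.
  by congr ('E_P[_])%E; apply/funext => w; apply: eq_bigr => i _; rewrite ffunE.
rewrite (@expectation_finite_valued _ _ _ _ _ X (fun z => character A z))//; congr EFin.
have m01 := measurable_unit_interval; set I := [set u : R | 0 <= u <= 1] in m01.
have mWI : measurable (W @^-1` I).
  exact: measurable_funPTI.
have PWI : P (W @^-1` I) = 1%E by rewrite -nu01; exact: WE.
rewrite (sym_moment_law _ WE).
pose b z w := \prod_(i < n) bernoulli_pmf (W w) (z i) : R.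
have intb (z : {ffun 'I_n -> bool}) : P.-integrable (W @^-1` I) (EFin \o b z).
  apply: (@bounded_integrable _ _ _ _ _ _ 1) => //.
    apply: measurable_funTS; apply: measurable_prod => i _.
    by rewrite /bernoulli_pmf; case: (z i) => //; exact: measurable_funB.
  move=> w Ww; have /andP[W0 W1] : 0 <= W w <= 1 by exact: Ww.
  rewrite normr_prod; apply: Num.Theory.prodr_ile1 => i _.
  rewrite normr_ge0/= /bernoulli_pmf; case: (z i); rewrite ger0_norm ?subr_ge0//; lra.
transitivity (\sum_(z : {ffun 'I_n -> bool})
    \int[P]_(w in W @^-1` I) (character A z * b z w)).
  apply: eq_bigr => z _; rewrite RintegralZl//; congr (_ * fine _).
  by rewrite -WZ// -XE probability_setI1.
transitivity (\int[P]_(w in W @^-1` I)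
    \sum_(z : {ffun 'I_n -> bool}) character A z * b z w).
  apply/esym; apply: (@Rintegral_sum _ _ _ P _ _ _
    (fun (z : {ffun 'I_n -> bool}) w => character A z * b z w)) => // z.
  exact: eq_integrable (integrableZl _ (character A z) (intb z)).
by apply: eq_Rintegral => w _; rewrite sum_bernoulli_character.
Qed.

End de_finetti_moments.

Lemma rhoE d (Omega : measurableType d) (R : realType) (P : probability Omega R)
    (nu : probability R R) (Z : nat -> {RV P >-> bool}) k :
  nu [set u | 0 <= u <= 1] = 1%E -> de_finetti nu Z ->
  rho Z k = sym_moment nu k.
Proof.
move=> nu01 ZdF; apply: EFin_inj; rewrite -[in RHS](card_ord k) -cardsT.
rewrite -(de_finetti_character nu01 _ ZdF) /rho.
rewrite (_ : (fun w => (-1) ^+ _) =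
  (fun w => character [set: 'I_k]%SET (fun i : 'I_k => Z i w))).
  by rewrite (de_finetti_character nu01 _ ZdF).
apply/funext => w; rewrite -prodrXr /character.
by apply: eq_bigl => i; rewrite finset.in_setT.
Qed.

Section finite_characters.
Context (R : realType).

Lemma character_addb (I : finType) (A : {set I}) (a b : I -> bool) :
  @character R I A (fun i => a i (+) b i) = character A a * character A b.
Proof. by rewrite /character -big_split; apply: eq_bigr => i _; rewrite signr_addb. Qed.

Lemma character_sum (I : finType) (A : {set I}) t (z : 'I_t -> I -> bool) :
  @character R I A (fun i => \big[addb/false]_(s < t) z s i) =
  \prod_(s < t) character A (z s).
Proof.
rewrite /character exchange_big; apply: eq_bigr => i _ /=.
by elim/big_rec2: _ => // s b r _ <-; rewrite signr_addb.
Qed.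

Lemma sum_character (N : nat) (e : 'I_N -> R) :
  \sum_(A : {set 'I_N}) \prod_(i in A) e i = \prod_(i < N) (1 + e i).
Proof.
under [RHS]eq_bigr do rewrite addrC.
rewrite bigA_distr; apply: eq_bigr => A _.
by rewrite big_mkcond.
Qed.

(** Orthogonality of characters, in the form used for Fourier inversion at 0:
    the mean of all characters at [e] is the indicator of [e = 0]. *)
Lemma fourier_indicator (N : nat) (e : 'I_N -> bool) :
  [forall i, ~~ e i]%:R = (1 / 2) ^+ N * \sum_(A : {set 'I_N}) @character R _ A e.
Proof.
rewrite sum_character.
have -> : (1 / 2) ^+ N = \prod_(i < N) (1 / 2 : R) by rewrite prodr_const card_ord.
rewrite -big_split /=; case: forallP => [e0|/forallP].
  rewrite big1// => i _; rewrite (negbTE (e0 i)) expr0; lra.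
rewrite negb_forall => /existsP[i]; rewrite negbK => ei.
by rewrite (bigD1 i)//= ei expr1 subrr mulr0 mul0r.
Qed.

End finite_characters.

(** * Transition probabilities and Green function *)

Section independence_of_the_steps.
Context d (Omega : measurableType d) (R : realType) (P : probability Omega R).
Variable Z : nat -> nat -> {RV P >-> bool}.
Hypothesis Z_indep :
  mutually_independent P (fun t => sigma_gen (fun j w => Z t j w)).

Lemma sigma_gen_cylinder s (I : finType) (c : I -> nat) (z : I -> bool) :
  sigma_gen (fun j w => Z s j w) [set w | forall i, Z s (c i) w = z i].
Proof.
pose G := \bigcup_j g_sigma_algebra_preimage (fun w => Z s j w).
apply: (@measurable_forall _ (g_sigma_algebraType G) I
  (fun i => [set w | Z s (c i) w = z i])) => i.
apply: sub_sigma_algebra; exists (c i) => //; exists [set z i] => //.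
by rewrite setTI.
Qed.

Lemma independent_steps t (E : 'I_t -> set Omega) :
  (forall s : 'I_t, sigma_gen (fun j w => Z s j w) (E s)) ->
  P [set w | forall s, E s w] = (\prod_(s < t) P (E s))%E.
Proof.
move=> mE.
(* the independence hypothesis concerns families of events indexed by [nat] *)
pose E' n := if insub n is Some s then E s else setT.
have E'E (s : 'I_t) : E' s = E s by rewrite /E' valK.
pose J := [fset n in iota 0 t]%fset.
transitivity (P (\bigcap_(n in [set` J]) E' n)).
  congr (P _); apply/seteqP; split => w /= Ew.
    by move=> n _; rewrite /E'; case: insubP.
  by move=> s; rewrite -E'E; apply: Ew; rewrite /= !inE/= mem_iota/=.
rewrite Z_indep => [|n _].
  rewrite (perm_big (iota 0 t)); last first.
    by apply: uniq_perm; rewrite ?fset_uniq ?iota_uniq// => n; rewrite !inE.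
  rewrite -[X in iota 0 X]subn0 -/(index_iota 0 t) big_mkord.
  by apply: eq_bigr => s _; rewrite E'E.
rewrite /E'; case: insubP => [s _ <-|_]; last first.
  by rewrite -setC0; apply: sigma_algebraC; exact: sigma_algebra0.
exact: mE.
Qed.

End independence_of_the_steps.

Section walk_transition.
Context d (Omega : measurableType d) (R : realType) (P : probability Omega R).
Variables (nu : probability R R) (Z : nat -> nat -> {RV P >-> bool}).
Hypothesis nu01 : nu [set u | 0 <= u <= 1] = 1%E.
Hypothesis Z_de_finetti : forall t, de_finetti nu (Z t).
Hypothesis Z_indep :
  mutually_independent P (fun t => sigma_gen (fun j w => Z t j w)).
Variables (N : nat) (c : 'I_N -> nat).
Hypothesis c_inj : injective c.

(** The chosen entries need not be an initial segment: they are seen as entries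
    among the first [n], for [n] large enough, and the other entries do not occur
    in the character. *)
Lemma de_finetti_subfamily_character t (A : {set 'I_N}) :
  'E_P[fun w => character A (fun i => Z t (c i) w)]%E = (sym_moment nu #|A|)%:E.
Proof.
have cn i : (c i < (\max_i c i).+1)%N by rewrite ltnS leq_bigmax.
pose c' i := Ordinal (cn i).
have c'_inj : injective c' by move=> i j [] /c_inj.
rewrite -(card_imset A c'_inj) -(de_finetti_character nu01 _ (Z_de_finetti t)).
congr ('E_P[_])%E; apply/funext => w.
by rewrite /character big_imset//= => i j _ _; exact: c'_inj.
Qed.

Let step t w : {ffun 'I_N -> bool} := [ffun i => Z t (c i) w].

Let stepE t z : [set w | step t w = z] = [set w | forall i, Z t (c i) w = z i].
Proof.
apply/seteqP; split => w /= => [<- i|h]; first by rewrite ffunE.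
by apply/ffunP => i; rewrite ffunE.
Qed.

Let measurable_step t z : measurable [set w | step t w = z].
Proof.
rewrite stepE.
apply: (@measurable_forall _ _ 'I_N (fun i => Z t (c i) @^-1` [set z i])) => i.
exact: measurable_funPTI.
Qed.

Lemma step_character t (A : {set 'I_N}) :
  \sum_(z : {ffun 'I_N -> bool}) character A z * fine (P [set w | step t w = z]) =
  sym_moment nu #|A|.
Proof.
apply: EFin_inj.
rewrite -(@expectation_finite_valued _ _ _ _ _ (step t) (fun z => character A z))//.
rewrite -(de_finetti_subfamily_character t).
by congr ('E_P[_])%E; apply/funext => w; apply: eq_bigr => i _; rewrite ffunE.
Qed.

Lemma walkE (x : {ffun 'I_N -> bool}) t i w :
  walk x (fun s j => Z s (c j)) t i w =
  x i (+) \big[addb/false]_(s < t) Z s (c i) w.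
Proof.
elim: t => [|t IH] /=; first by rewrite big_ord0 addbF.
by rewrite IH big_ord_recr /= addbA.
Qed.

(** The law of the sequence of steps is a product by independence, and a character
    of the sum of the steps is the product of the characters; so the sum over all
    sequences of steps factors into [t] equal Fourier coefficients. *)
Lemma transitionE t (y x : {ffun 'I_N -> bool}) :
  transition Z c t y x =
  ((1 / 2) ^+ N * \sum_(A : {set 'I_N})
     character A (fun i => x i (+) y i) * sym_moment nu #|A| ^+ t)%:E.
Proof.
pose path w : {ffun 'I_t -> {ffun 'I_N -> bool}} := [ffun s : 'I_t => step s w].
pose hit (z : {ffun 'I_t -> {ffun 'I_N -> bool}}) :=
  [forall i, ~~ ((x i (+) y i) (+) \big[addb/false]_(s < t) z s i)].
have pathE z : [set w | path w = z] = [set w | forall s : 'I_t, step s w = z s].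
  apply/seteqP; split => w /= => [<- s|h]; first by rewrite ffunE.
  by apply/ffunP => s; rewrite ffunE.
have mpath z : measurable [set w | path w = z].
  rewrite pathE.
  by apply: (@measurable_forall _ _ 'I_t (fun s : 'I_t => [set w | step s w = z s])).
have path_prob z : fine (P [set w | path w = z]) =
    \prod_(s < t) fine (P [set w | step s w = z s]).
  apply: EFin_inj; rewrite -prodEFin fineK ?fin_num_measure// pathE.
  rewrite (@independent_steps _ _ _ _ _ Z_indep _
    (fun s : 'I_t => [set w | step s w = z s])).
    by apply: eq_bigr => s _; rewrite fineK// fin_num_measure.
  by move=> s; rewrite stepE; exact: sigma_gen_cylinder.
transitivity ('E_P[fun w => (hit (path w))%:R])%E.
  have hitE : [set w | forall i, walk x (fun s j => Z s (c j)) t i w = y i] =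
              [set w | hit (path w)].
    have sumE w i : \big[addb/false]_(s < t) path w s i =
                    \big[addb/false]_(s < t) Z s (c i) w.
      by apply: eq_bigr => s _; rewrite !ffunE.
    apply/seteqP; split => w /=.
      move=> walky; apply/forallP => i; have := walky i; rewrite walkE sumE => <-.
      by rewrite addKb addbb.
    move=> /forallP hitw i; have := hitw i; rewrite walkE sumE.
    by case: (x i) (y i) (\big[_/_]_(_ < _) _) => [] [] [].
  rewrite /transition hitE.
  have mhit : measurable [set w | hit (path w)].
    rewrite (_ : mkset _ = \bigcup_(z in [set z | hit z]) [set w | path w = z]).
      by apply: fin_bigcup_measurable => // z _; exact: mpath.
    by apply/seteqP; split => [w hw|w [z /= hz ->//]]; exists (path w).
  rewrite -(expectation_indic P mhit); congr ('E_P[_])%E; apply/funext => w.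
  rewrite indicE; congr ((nat_of_bool _)%:R); apply/idP/idP => [h|h].
    exact: (set_mem h).
  exact: mem_set.
rewrite (@expectation_finite_valued _ _ _ _ _ path (fun z => (hit z)%:R))//.
congr EFin.
under eq_bigr => z _.
  rewrite /hit fourier_indicator path_prob -mulrA mulr_suml.
  under eq_bigr do rewrite character_addb character_sum -mulrA -big_split/=.
  over.
rewrite -mulr_sumr; congr (_ * _); rewrite exchange_big; apply: eq_bigr => A _ /=.
rewrite -mulr_sumr; congr (_ * _).
rewrite -(@bigA_distr_bigA _ _ _ _ _ 'I_t _
  (fun (s : 'I_t) (z : {ffun 'I_N -> bool}) =>
     character A z * fine (P [set w | step s w = z]))).
under eq_bigr do rewrite step_character.
by rewrite prodr_const card_ord.
Qed.

Lemma greenE (alpha : R) (y x : {ffun 'I_N -> bool}) : 0 < alpha < 1 ->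
  ((1 - alpha)%:E * green Z c x y alpha)%E =
  ((1 / 2) ^+ N * \sum_(A : {set 'I_N}) character A (fun i => x i (+) y i) *
    (1 / (1 + alpha / (1 - alpha) * (1 - sym_moment nu #|A|))))%:E.
Proof.
move=> /andP[a0 a1].
pose m (A : {set 'I_N}) := sym_moment nu #|A|.
pose chi (A : {set 'I_N}) : R := character A (fun i => x i (+) y i).
have m1 A : `|m A| <= 1 by exact: sym_moment_le1.
have am1 A : `|alpha * m A| < 1.
  rewrite normrM (gtr0_norm a0) (le_lt_trans _ a1)//.
  by rewrite -[leRHS]mulr1 ler_pM2l.
have -> : green Z c x y alpha =
    ((1 / 2) ^+ N * \sum_(A : {set 'I_N}) chi A / (1 - alpha * m A))%:E.
  rewrite /green; apply: cvg_lim => //.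
  rewrite (_ : (fun _ => _) = EFin \o (fun n => (1 / 2) ^+ N *
      \sum_(A : {set 'I_N}) series (geometric (chi A) (alpha * m A)) n)).
    apply: cvg_EFin; first exact: nearW.
    apply: cvgMl_tmp; apply: cvg_big => [|A _]; first exact: add_continuous.
    exact: cvg_geometric_series.
  apply/funext => n /=.
  under eq_bigr do rewrite transitionE -EFinM.
  rewrite sumEFin; congr EFin.
  rewrite exchange_big /= mulr_sumr; apply: eq_bigr => t _.
  rewrite mulrCA; congr (_ * _); rewrite mulr_sumr; apply: eq_bigr => A _.
  by rewrite exprMn mulrCA.
rewrite -EFinM; congr EFin; rewrite mulrCA; congr (_ * _).
rewrite mulr_sumr; apply: eq_bigr => A _; rewrite -/(chi A) -/(m A).
have an0 : 1 - alpha * m A != 0.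
  by rewrite gt_eqF// subr_gt0 (le_lt_trans (ler_norm _)).
rewrite mulrCA; congr (_ * _).
have -> : 1 + alpha / (1 - alpha) * (1 - m A) = (1 - alpha * m A) / (1 - alpha).
  by field; rewrite subr_eq0 gt_eqF.
by field; rewrite an0 subr_eq0 gt_eqF.
Qed.

End walk_transition.

(** The set in [hamming] is a classical one, used as a predicate. *)
Lemma hammingE (N : nat) (x y : {ffun 'I_N -> bool}) :
  hamming x y = #|[pred i | x i != y i]|.
Proof.
by apply: eq_card => i; rewrite [RHS]inE; apply/idP/idP => [/set_mem|/mem_set].
Qed.

(** Expanding the product over the entries [i] of [(1 + e i * u) / 2], where
    [e i] is -1 if [x] and [y] differ at [i] and 1 otherwise. *)
Lemma fourier_hamming (R : realType) (N : nat) (x y : {ffun 'I_N -> bool}) (u : R) :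
  (1 / 2) ^+ N * \sum_(A : {set 'I_N}) character A (fun i => x i (+) y i) * u ^+ #|A| =
  (1 / 2 - u / 2) ^+ hamming y x * (1 / 2 + u / 2) ^+ (N - hamming y x).
Proof.
pose e i : R := (-1) ^+ (x i (+) y i) * u.
under eq_bigr => A _ do rewrite -prodr_const -big_split/=.
rewrite (sum_character e).
have -> : (1 / 2) ^+ N = \prod_(i < N) (1 / 2 : R) by rewrite prodr_const card_ord.
rewrite -big_split /= (bigID [pred i | y i != x i]) /= hammingE.
have -> : (N - #|[pred i | y i != x i]| = #|predC [pred i | y i != x i]|)%N.
  by rewrite -{1}(card_ord N) -(cardC [pred i | y i != x i]) addKn.
rewrite -!prodr_const; congr (_ * _).
  apply: eq_bigr => i yx; rewrite /e; have -> : x i (+) y i = true.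
    by move: yx; case: (x i); case: (y i).
  by rewrite expr1; ring.
apply: eq_bigr => i; rewrite /e negbK => /eqP ->.
by rewrite addbb expr0; ring.
Qed.

Lemma expectation_hamming d (Omega : measurableType d) (R : realType)
    (P : probability Omega R) (Y : Omega -> R) (N : nat)
    (x y : {ffun 'I_N -> bool}) (m : nat -> R) :
  measurable_fun setT Y -> (forall w, `|Y w| <= 1) ->
  (forall k, 'E_P[(fun w => Y w ^+ k)%R]%E = (m k)%:E) ->
  'E_P[(fun w => (1 / 2 - Y w / 2) ^+ hamming y x *
                 (1 / 2 + Y w / 2) ^+ (N - hamming y x)%N)%R]%E =
  ((1 / 2) ^+ N * \sum_(A : {set 'I_N}) character A (fun i => x i (+) y i) * m #|A|)%:E.
Proof.
move=> mY Y1 Ym; rewrite unlock.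
have intY k : P.-integrable setT (EFin \o (fun w => Y w ^+ k)).
  apply: (@bounded_integrable _ _ _ _ _ _ 1) => //; first exact: measurable_funX.
  by move=> w _; rewrite normrX exprn_ile1.
pose a (A : {set 'I_N}) := (1 / 2) ^+ N * character A (fun i => x i (+) y i) : R.
transitivity (\int[P]_w (\sum_(A : {set 'I_N}) (a A)%:E * (Y w ^+ #|A|)%:E))%E.
  apply: eq_integral => w _; rewrite -fourier_hamming mulr_sumr -sumEFin.
  by apply: eq_bigr => A _; rewrite mulrA EFinM.
rewrite integral_sum//; last first.
  by move=> A; exact: (integrableZl _ (a A) (intY _)).
rewrite mulr_sumr -sumEFin; apply: eq_bigr => A _.
rewrite integralZl//; last exact: (intY #|A|).
have := Ym #|A|; rewrite unlock => ->.
by rewrite -EFinM mulrA.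
Qed.

(** * A point process with a geometric number of i.i.d. points *)

Section existence.
Context (R : realType).

Definition coordinate_events : set (set (nat -> R)) :=
  \bigcup_j preimage_set_system setT (fun x : nat -> R => x j) measurable.

Definition sequence := g_sigma_algebraType coordinate_events.

(** A pair [(n, x)] stands for the points [x 0], ..., [x n.-1]. *)
Definition configuration := (nat * sequence)%type.

Lemma measurable_coordinate j : measurable_fun [set: sequence] (fun x : sequence => x j).
Proof.
move=> _ B mB; apply: sub_sigma_algebra; exists j => //.
by exists B.
Qed.

Lemma measurable_fun_sequence d (T : measurableType d) (h : T -> sequence) :
  (forall j, measurable_fun setT (fun w => h w j)) -> measurable_fun setT h.
Proof.
move=> mh; apply: (@measurability _ _ T sequence setT h coordinate_events) => //.
move=> _ [_ [j _ [B mB <-]] <-].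
by rewrite !setTI; have := mh j measurableT B mB; rewrite setTI.
Qed.

Definition add_point (p : R * configuration) : configuration :=
  (p.2.1.+1, (fun j => if j is j'.+1 then p.2.2 j' else p.1) : sequence).

Lemma measurable_add_point : measurable_fun setT add_point.
Proof.
have m2 := @measurable_snd _ _ R configuration.
apply: measurable_fun_pair.
  apply: (@measurableT_comp _ _ _ _ _ _ S) => //.
  exact: (measurableT_comp measurable_fst m2).
apply: measurable_fun_sequence => -[|j] /=; first exact: measurable_fst.
exact: (measurableT_comp (measurable_coordinate j) (measurableT_comp measurable_snd m2)).
Qed.

HB.instance Definition _ := isMeasurableFun.Build _ _ _ _ add_point measurable_add_point.

Variable nu : probability R R.

Fixpoint iid_points (n : nat) : probability configuration R :=
  if n is n'.+1 then distribution (sym_law nu \x iid_points n')%E add_point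
  else \d_((0%N, (fun=> 0) : sequence) : configuration).

Lemma measurable_prod_points (g : R -> R) : measurable_fun setT g ->
  measurable_fun setT (fun q : configuration => \prod_(j < q.1) g (q.2 j)).
Proof.
move=> mg.
apply: (@measurable_fun_random_index _ _ _ _ (fun q : configuration => q.1)
  (fun n (q : configuration) => \prod_(j < n) g (q.2 j))) => [|n].
  exact: measurable_fst.
apply: measurable_prod => j _.
exact: (measurableT_comp mg (measurableT_comp (measurable_coordinate j)
  (@measurable_snd _ _ nat sequence))).
Qed.

Section product_functional.
Variables (g : R -> R) (m : R).
Hypotheses (mg : measurable_fun setT g) (g0 : forall u, 0 <= g u).
Hypothesis gm : (\int[sym_law nu]_u (g u)%:E)%E = m%:E.

Let prod_g (q : configuration) : R := \prod_(j < q.1) g (q.2 j).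

Let prod_g_ge0 q : 0 <= prod_g q. Proof. exact: prodr_ge0. Qed.

Let measurable_prod_g : measurable_fun setT prod_g := measurable_prod_points mg.

(** Fubini, one point at a time. *)
Lemma integral_iid_points n :
  (\int[iid_points n]_q (\prod_(j < q.1) g (q.2 j))%:E)%E = (m ^+ n)%:E.
Proof.
have mE : measurable_fun setT (EFin \o prod_g) by exact/measurable_EFinP.
elim: n => [|n IH]; first by rewrite integral_dirac//= big_ord0 diracT mul1e.
rewrite [LHS](@ge0_integral_distribution _ _ _ _ _ _ add_point (EFin \o prod_g))//.
transitivity (\int[sym_law nu \x iid_points n]_p ((g p.1)%:E * (prod_g p.2)%:E))%E.
  by apply: eq_integral => p _; rewrite /= /prod_g /= big_ord_recl/= EFinM.
rewrite fubini_tonelli1//=; last 2 first.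
- apply: emeasurable_funM; apply/measurable_EFinP.
    exact: (measurableT_comp mg measurable_fst).
  exact: (measurableT_comp measurable_prod_g measurable_snd).
- by move=> p; rewrite mule_ge0// lee_fin.
transitivity (\int[sym_law nu]_u ((g u)%:E * (m ^+ n)%:E))%E.
  apply: eq_integral => u _; rewrite /fubini_F /=.
  rewrite ge0_integralZl ?lee_fin//; first by rewrite IH.
  by move=> q _; rewrite lee_fin.
rewrite ge0_integralZr//; first by rewrite gm -EFinM exprS.
- exact/measurable_EFinP.
- by move=> u _; rewrite lee_fin.
- by rewrite -IH; apply: integral_ge0 => q _; rewrite lee_fin; exact: prod_g_ge0.
Qed.

End product_functional.

Variable alpha : R.
Hypothesis alpha01 : 0 < alpha < 1.

Let weight n : R := (1 - alpha) * alpha ^+ n.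

Let weight_ge0 n : 0 <= weight n.
Proof. by case/andP: alpha01 => a0 a1; rewrite mulr_ge0 ?exprn_ge0// ltW// subr_gt0. Qed.

Let norm_alpha : `|alpha| < 1.
Proof. by case/andP: alpha01 => a0 a1; rewrite gtr0_norm. Qed.

Definition geometric_points : set configuration -> \bar R :=
  mseries (fun n => mscale (NngNum (weight_ge0 n)) (iid_points n)) 0.

HB.instance Definition _ := Measure.on geometric_points.

Let geometric_points_setT : geometric_points setT = 1%E.
Proof.
rewrite /geometric_points /mseries.
transitivity (\sum_(0 <= n <oo) (weight n)%:E)%E.
  apply: eq_eseriesr => n _; rewrite -[RHS]mule1; congr (_ * _)%E.
  exact: probability_setT.
rewrite geometric_eseries ?divff// gt_eqF// subr_gt0.
by case/andP: alpha01.
Qed.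

HB.instance Definition _ :=
  Measure_isProbability.Build _ _ _ geometric_points geometric_points_setT.

(** Points of a configuration are arbitrary reals, although almost surely in
    [[-1, 1]]; clamping them makes this hold everywhere. *)
Definition clamp (u : R) : R := Num.max (-1) (Num.min u 1).

Lemma clamp_itv u : -1 <= clamp u <= 1.
Proof. by rewrite /clamp le_max lexx/= ge_max ge_min lexx orbT andbT; lra. Qed.

Lemma clamp_id u : -1 <= u <= 1 -> clamp u = u.
Proof. by case/andP => u0 u1; rewrite /clamp (min_idPl u1) (max_idPr u0). Qed.

Lemma measurable_clamp : measurable_fun setT clamp.
Proof. by apply: measurable_maxr => //; exact: measurable_minr. Qed.

Let card (q : configuration) : nat := q.1.+1.

Let measurable_card : measurable_fun setT card.
Proof.
by apply: (@measurableT_comp _ _ _ _ _ _ S).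
Qed.

HB.instance Definition _ := isMeasurableFun.Build _ _ _ _ card measurable_card.

Let point (j : nat) (q : configuration) : R :=
  if j is j'.+1 then clamp (q.2 j') else 1.

Let measurable_point j : measurable_fun setT (point j).
Proof.
case: j => [|j]; first exact: measurable_cst.
exact: (measurableT_comp measurable_clamp (measurableT_comp (measurable_coordinate j)
  (@measurable_snd _ _ nat sequence))).
Qed.

HB.instance Definition _ j :=
  isMeasurableFun.Build _ _ _ _ (point j) (measurable_point j).

Let point_itv (q : configuration) j : (j < card q)%N -> -1 <= point j q <= 1.
Proof. by case: j => [|j] _; [rewrite /= lexx andbT; lra | exact: clamp_itv]. Qed.

(** The point of index 0 is the deterministic one. *)
Definition geometric_process : point_process geometric_points :=
  @PointProcess _ _ _ geometric_points card point point_itv.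

Hypothesis nu01 : nu [set u | 0 <= u <= 1] = 1%E.

Lemma geometric_process_pgfl : has_pgfl geometric_process (geometric_pgfl nu alpha).
Proof.
move=> f mf f01.
pose J := `[(-1 : R), 1]%classic; have mJ : measurable J by exact: measurable_itv.
have JP u : J u -> -1 <= u <= 1 by rewrite /J /= in_itv.
(* [f] is only controlled on [[-1, 1]], [g] everywhere *)
pose g := f \o clamp; pose m := \int[sym_law nu]_(u in J) f u.
have g01 u : 0 <= g u <= 1 by apply: f01; exact: clamp_itv.
have g0 u : 0 <= g u by case/andP: (g01 u).
have mg : measurable_fun setT g.
  apply: (measurable_comp mJ _ mf); last exact: measurable_clamp.
  by move=> _ [u _ <-]; exact: clamp_itv.
have intf : (sym_law nu).-integrable J (EFin \o f).
  apply: (@bounded_integrable _ _ _ _ _ _ 1) => // u /JP u1.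
  by have /andP[f0 f1] := f01 _ u1; rewrite ger0_norm.
have gm : (\int[sym_law nu]_u (g u)%:E)%E = m%:E.
  have J0 : sym_law nu (~` J) = 0%E.
    rewrite probability_setC//.
    by rewrite (_ : _ J = 1%E) ?subee//; exact: sym_law_itv.
  rewrite (ge0_negligible_integral (measurableC mJ) measurableT)//=; last 2 first.
  - exact/measurable_EFinP.
  - by move=> u _; rewrite lee_fin.
  rewrite setTD setCK /m /Rintegral fineK; last exact: integrable_fin_num.
  by apply: eq_integral => u; rewrite inE => /JP u1; rewrite /g /= clamp_id.
have m01 : 0 <= m <= 1.
  rewrite Rintegral_ge0 => [/=|u /JP u1]; last by case/andP: (f01 _ u1).
  rewrite -(Rintegral_sym_law_cst nu01 1); apply: le_Rintegral => //.
    by apply: sym_law_integrable => // u _; rewrite normr1.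
  by move=> u /JP u1; case/andP: (f01 _ u1).
have f1_ge0 : 0 <= f 1.
  have one_itv : -1 <= (1 : R) <= 1 by rewrite lexx andbT; lra.
  by have /andP[] := f01 _ one_itv.
have am1 : `|alpha * m| < 1.
  case/andP: m01 => m0 m1.
  by rewrite normrM (ger0_norm m0) (le_lt_trans _ norm_alpha)// ler_piMr.
have prodE q : pp_prod geometric_process f q = f 1 * \prod_(j < q.1) g (q.2 j).
  by rewrite /pp_prod /= big_ord_recl.
have mprod : measurable_fun setT (EFin \o pp_prod geometric_process f).
  apply/measurable_EFinP; rewrite (funext prodE); apply: measurable_funM => //.
  exact: measurable_prod_points.
have prod0 q : (0 <= (pp_prod geometric_process f q)%:E)%E.
  by rewrite lee_fin prodE mulr_ge0// prodr_ge0.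
rewrite /pgfl unlock ge0_integral_measure_series//.
transitivity (\sum_(0 <= n <oo) (f 1 * (1 - alpha) * (alpha * m) ^+ n)%:E)%E.
  apply: eq_eseriesr => n _; rewrite ge0_integral_mscale//=.
  under eq_integral do rewrite prodE EFinM.
  rewrite ge0_integralZl//; last 2 first.
  - by apply/measurable_EFinP; exact: measurable_prod_points.
  - by move=> q _; rewrite lee_fin prodr_ge0.
  rewrite (integral_iid_points mg g0 gm) -!EFinM /weight exprMn.
  by congr EFin; ring.
rewrite geometric_eseries//; congr EFin.
rewrite /geometric_pgfl RintegralB//; last first.
  by apply: sym_law_integrable => // u _; rewrite normr1.
rewrite Rintegral_sym_law_cst// -/m.
have : 1 - alpha * m != 0 by rewrite gt_eqF// subr_gt0 (le_lt_trans (ler_norm _)).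
have : 1 - alpha != 0 by rewrite gt_eqF// subr_gt0 (le_lt_trans (ler_norm _)).
move=> n1 n2.
have -> : 1 + alpha / (1 - alpha) * (1 - m) = (1 - alpha * m) / (1 - alpha).
  by field.
by field; rewrite n1 n2.
Qed.

End existence.

(** * The theorem *)

Theorem proposition7 (R : realType) (d : measure_display)
    (Omega : measurableType d) (P : probability Omega R)
    (nu : probability R R) (nu01 : nu [set u | 0 <= u <= 1] = 1%E)
    (Z : nat -> nat -> {RV P >-> bool})
    (Z_de_finetti : forall t, de_finetti nu (Z t))
    (Z_indep : mutually_independent P (fun t => sigma_gen (fun j w => Z t j w)))
    (alpha : R) (alpha01 : 0 < alpha < 1)
    (T : {RV P >-> nat})
    (T_law : forall t, P (T @^-1` [set t]) = ((1 - alpha) * alpha ^+ t)%:E)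
    (T_indep : independent P
       (sigma_gen (fun (_ : unit) w => T w))
       (sigma_gen (fun tj : nat * nat =>
          walk (fun=> false) (fun t j w => Z t j w) tj.1 tj.2))) :
  (exists (d' : measure_display) (Omega' : measurableType d')
          (Q : probability Omega' R) (xi : point_process Q),
      has_pgfl xi (geometric_pgfl nu alpha))
  /\
  (forall (d' : measure_display) (Omega' : measurableType d')
          (Q : probability Omega' R) (xi : point_process Q),
      has_pgfl xi (geometric_pgfl nu alpha) ->
      let Y := pp_prod xi id in
      [/\ measurable_fun setT Y /\ (forall w, -1 <= Y w <= 1),
          forall t k : nat,
            (1 / (1 + alpha / (1 - alpha) * (1 - rho (Z t) k)))%:E
            = ('E_Q[(fun w => Y w ^+ k)%R])%E
        & forall (N : nat) (c : 'I_N -> nat), injective c ->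
          forall x y : {ffun 'I_N -> bool},
            ((1 - alpha)%:E * green Z c x y alpha)%E
            = ('E_Q[(fun w => (1 / 2 - Y w / 2) ^+ hamming y x *
                              (1 / 2 + Y w / 2) ^+ (N - hamming y x)%N)%R])%E]).
Proof.
split.
  exists _, _, _, (geometric_process nu alpha01).
  exact: geometric_process_pgfl.
move=> d' Omega' Q xi xiG Y.
have moments k := expectation_pp_prod_power nu01 alpha01 k xiG.
have mY : measurable_fun setT Y by exact: measurable_pp_prod.
have Y1 w : `|Y w| <= 1 by apply: pp_prod_bounded => u; rewrite ler_norml.
split.
- by split=> // w; rewrite -ler_norml.
- by move=> t k; rewrite (rhoE k nu01 (Z_de_finetti t)) moments.
- move=> N c c_inj x y; rewrite (greenE nu01 Z_de_finetti Z_indep c_inj _ _ alpha01).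
  by rewrite (expectation_hamming x y mY Y1 moments).
Qed.
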